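(* Let $l$ be a positive integer and put $m_0=\binom{l-1}{3}+\binom{l-2}{2}$. Suppose that every left-compressed 3-graph $G$ on the vertex set $[l]=\{1,\dots,l\}$ with exactly $m_0$ edges which does not contain the clique $[l-1]^{(3)}$ (i.e. not all triples of $\{1,\dots,l-1\}$ are edges of $G$) satisfies $\lambda(G)<\lambda([l-1]^{(3)})$. Then for every integer $m$ with $\binom{l-1}{3}\le m\le \binom{l-1}{3}+\binom{l-2}{2}$ and every (finite) 3-graph $G$ with $m$ edges that contains no clique of order $l-1$, we have $\lambda(G)<\lambda([l-1]^{(3)})$.
   Context: A 3-graph $G$ consists of a finite vertex set $V(G)$ and an edge set $E(G)\subseteq V(G)^{(3)}$, the family of 3-element subsets of $V(G)$. For $V(G)=[n]$, the Lagrangian is $\lambda(G)=\max\{\sum_{i_1i_2i_3\in E(G)}x_{i_1}x_{i_2}x_{i_3} : x\in\mathbb{R}^n,\ x_i\ge 0,\ \sum_i x_i=1\}$ (for a general finite vertex set, label the vertices $1,\dots,n$). $[t]^{(3)}$ denotes the complete 3-graph on vertex set $[t]$. A clique of order $t$ in $G$ is a set of $t$ vertices all of whose 3-subsets are edges of $G$. A 3-graph $G$ on $[n]$ is left-compressed if whenever $j_1j_2j_3\in E(G)$ (with $j_1<j_2<j_3$) and $i_1<i_2<i_3$ satisfy $i_p\le j_p$ for $p=1,2,3$, then $i_1i_2i_3\in E(G)$.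
   Formalization: The 3-graph G in the conclusion is assumed to have at least two vertices; otherwise the claim fails for l=3, m=0 and the one-vertex edgeless graph (both Lagrangians are 0), and the Lagrangian is undefined for an empty vertex set. *)

(* Defs.v *)
From HB Require Import structures.
From mathcomp Require Import all_boot all_order all_algebra.
From mathcomp Require Import all_classical all_reals all_analysis.

Set Implicit Arguments.
Unset Strict Implicit.
Unset Printing Implicit Defensive.

Import Order.TTheory GRing.Theory Num.Theory numFieldNormedType.Exports.

Local Open Scope ring_scope.
Local Open Scope classical_set_scope.

Record three_graph (V : finType) := ThreeGraph {
  edges :> {set {set V}};
  edges_card3 : {in edges, forall e : {set V}, #|e| = 3} }.

Definition complete_edges (V : finType) : {set {set V}} :=
  [set e : {set V} | #|e| == 3]%SET.

Lemma complete_edges_card3 (V : finType) :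
  {in complete_edges V, forall e : {set V}, #|e| = 3}.
Proof. by move=> e; rewrite inE => /eqP. Qed.

(* The vertices 1, ..., t are represented by 0, ..., t - 1. *)
Definition complete_three_graph (t : nat) : three_graph 'I_t :=
  ThreeGraph (@complete_edges_card3 'I_t).

(* Every set of at most two vertices is vacuously a clique. *)
Definition is_clique (V : finType) (G : three_graph V) (K : {set V}) : Prop :=
  forall e : {set V}, e \subset K -> #|e| = 3 -> e \in edges G.

Definition has_clique (V : finType) (G : three_graph V) (t : nat) : Prop :=
  exists2 K : {set V}, #|K| = t & is_clique G K.

Definition left_compressed (n : nat) (G : three_graph 'I_n) : Prop :=
  forall i1 i2 i3 j1 j2 j3 : 'I_n,
    (j1 < j2)%N -> (j2 < j3)%N -> [set j1; j2; j3]%SET \in edges G ->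
    (i1 < i2)%N -> (i2 < i3)%N ->
    (i1 <= j1)%N -> (i2 <= j2)%N -> (i3 <= j3)%N ->
    [set i1; i2; i3]%SET \in edges G.

Definition simplex (R : realType) (V : finType) : set (V -> R) :=
  [set x | (forall i, 0 <= x i) /\ \sum_i x i = 1].

Definition lagrangian_poly (R : realType) (V : finType) (G : three_graph V)
    (x : V -> R) : R :=
  \sum_(e in edges G) \prod_(i in e) x i.

(* For nonempty V this supremum is a maximum, see [lagrangian_max] below; for
   empty V the simplex is empty and the value is the junk value [sup set0]. *)
Definition lagrangian (R : realType) (V : finType) (G : three_graph V) : R :=
  sup [set lagrangian_poly G x | x in @simplex R V].

Lemma simplex_nonempty (R : realType) (V : finType) :
  (0 < #|V|)%N -> @simplex R V !=set0.
Proof.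
case/card_gt0P => v _; exists (fun i => (i == v)%:R); split.
  by move=> i; rewrite ler0n.
by rewrite (bigD1 v) //= eqxx big1 ?addr0 // => i /negPf ->.
Qed.

Lemma coord_continuous (R : realType) (V : finType) (i : V) :
  continuous ((fun x => x i) : prod_topology (fun _ : V => R) -> R).
Proof. exact: (@proj_continuous V (fun=> R) i). Qed.

Lemma simplex_compact (R : realType) (V : finType) :
  compact (@simplex R V : set (prod_topology (fun _ : V => R))).
Proof.
have cb : compact [set x : prod_topology (fun _ : V => R) |
    forall i, `[0, 1]%classic (x i)].
  by apply: (@tychonoff V (fun=> R) (fun=> `[0, 1]%classic)) => i;
    exact: segment_compact.
apply: (subclosed_compact _ cb); last first.
  move=> x [x0 x1] i /=; rewrite in_itv /= x0 /= -x1 (bigD1 i) //= lerDl.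
  by apply: sumr_ge0.
have -> : @simplex R V =
    \bigcap_(i in [set: V])
      ((fun x : prod_topology (fun _ : V => R) => x i) @^-1` [set y | 0 <= y])
    `&` ((fun x : prod_topology (fun _ : V => R) => \sum_i x i) @^-1` [set 1]).
  apply/seteqP; split=> x /= [x0 x1]; split=> // i; last exact: x0.
  by move=> _; exact: x0.
apply: closedI.
  apply: closed_bigI => i _; apply: preimage_closed; last exact: closed_ge.
  by move=> x _; exact: coord_continuous.
apply: preimage_closed; last exact: closed_eq.
by move=> x _; apply: (continuous_big (@add_continuous R)) => i _; exact: coord_continuous.
Qed.

Lemma lagrangian_poly_continuous (R : realType) (V : finType)
    (G : three_graph V) :
  continuous (@lagrangian_poly R V G : prod_topology (fun _ : V => R) -> R).
Proof.
apply: (continuous_big (@add_continuous R)) => e _.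
by apply: (continuous_big (@mul_continuous R)) => i _; exact: coord_continuous.
Qed.

Lemma lagrangian_max (R : realType) (V : finType) (G : three_graph V) :
  (0 < #|V|)%N ->
  exists2 x : V -> R, @simplex R V x &
    lagrangian R G = lagrangian_poly G x /\
    forall y, @simplex R V y -> lagrangian_poly G y <= lagrangian_poly G x.
Proof.
move=> V0.
have [x xS xmax] : exists2 x, @simplex R V x &
    forall y, @simplex R V y -> lagrangian_poly G y <= lagrangian_poly G x.
  have [] := @compact_EVT_max (prod_topology (fun _ : V => R)) R
    (@lagrangian_poly R V G) _ (simplex_nonempty R V0) (@simplex_compact R V).
  - exact/continuous_subspaceT/lagrangian_poly_continuous.
  - by move=> x xS xm; exists x; [rewrite inE in xS|];
      move=> // y yS; apply: xm; rewrite inE.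
exists x => //; split=> //; apply/eqP; rewrite eq_le; apply/andP; split.
  by apply: ge_sup => [|_ [y yS <-]]; [exists (lagrangian_poly G x), x | exact: xmax].
by apply: ub_le_sup; [exists (lagrangian_poly G x) => _ [y yS <-]; exact: xmax | exists x].
Qed.

(* Main.v *)
(* Put t = l - 1. Among all triple systems with at most m_0 edges on the given
   vertex set, and all weightings, choose a pair (E, x) of maximal value, with x
   of minimal support. Swapping an edge for an equally heavy non-edge would give
   a second optimal pair, and the first order conditions of the two are
   incompatible; so every edge of E is strictly heavier than every non-edge. In
   particular E is left-compressed, without any compression step that could
   create a clique. If the support has at least t + 2 vertices, the lightest
   vertex can be merged into the next one, and the freed edges spent on heavier
   non-edges. If it has at most t vertices, or t + 1 vertices and a clique of
   order t, the first order conditions bound the value by the Lagrangian of the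
   t-clique. The remaining case is excluded by the hypothesis. So the maximum is
   attained only by systems with a t-clique, and a G with Lagrangian at least
   that of the t-clique would attain it. *)
Require Import Defs.
From mathcomp Require Import all_boot all_order all_algebra.
From mathcomp Require Import all_classical all_reals all_analysis.
From mathcomp Require Import ring lra zify.
(* Re-imported so that their lemma names take precedence over classical_sets. *)
From mathcomp Require Import fintype finset.

Set Implicit Arguments.
Unset Strict Implicit.
Unset Printing Implicit Defensive.

Import Order.TTheory GRing.Theory Num.Theory.

Local Open Scope ring_scope.

(* The [3] of [complete_edges_card3] is the ring numeral [3%:R : nat]. *)
Lemma card_triple (V : finType) (e : {set V}) : e \in complete_edges V -> #|e| = 3%N.
Proof. exact: complete_edges_card3. Qed.

(** * Edge polynomials, their derivatives and transfers of weight *)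

Section Polynomial.
Variables (R : realType) (V : finType).
Implicit Types (x y : V -> R) (E F : {set {set V}}) (S e : {set V}).

(* The partial derivative of the edge polynomial of E along the vertices of S;
   at [S = set0] this is the polynomial itself, and at [x = 1] the number of
   edges containing S. *)
Definition pderiv x E S : R :=
  \sum_(e in E | S \subset e) \prod_(i in e :\: S) x i.

Definition wpoly x E : R := \sum_(e in E) \prod_(i in e) x i.

Definition transfer x (i j : V) (d : R) : V -> R :=
  fun k => x k + d * ((k == i)%:R - (k == j)%:R).

Lemma pderiv0 x E : pderiv x E set0 = wpoly x E.
Proof.
rewrite /pderiv /wpoly; apply: eq_big => [e|e _]; first by rewrite sub0set andbT.
by apply: eq_bigl => i; rewrite !inE.
Qed.

Lemma pderiv1 E S : pderiv (fun=> 1) E S = #|[set e in E | S \subset e]|%:R.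
Proof.
rewrite /pderiv -sum1_card natr_sum; apply: eq_big => [e|e _]; first by rewrite !inE.
by rewrite big1.
Qed.

(** Euler's identity for a form of degree 3 - |S|: an edge containing S is counted once for each of
    its vertices outside S. *)
Lemma euler x E S : E \subset complete_edges V ->
  \sum_(i | i \notin S) x i * pderiv x E (i |: S) =
  (3 - #|S|)%:R * pderiv x E S.
Proof.
move=> /subsetP Ec; rewrite /pderiv big_distrr /=.
under eq_bigr => i _ do rewrite big_distrr /=.
rewrite (exchange_big_dep [pred e | (e \in E) && (S \subset e)]) /=; last first.
  by move=> i e _; rewrite subUset => /andP[-> /andP[_ ->]].
apply: eq_bigr => e /andP[eE Se].
have e3 : #|e| = 3%N by apply: complete_edges_card3; exact: Ec.
have <- : #|e :\: S| = (3 - #|S|)%N by rewrite cardsD (setIidPr Se) e3.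
rewrite mulr_natl -sumr_const; apply: eq_big => [i|i /and3P[iS _]].
  by rewrite !inE eE subUset sub1set Se andbT.
rewrite subUset sub1set => /andP[ie _].
rewrite [RHS](bigD1 i) /=; last by rewrite inE iS.
congr (_ * _); apply: eq_bigl => k; rewrite !inE negb_or.
by rewrite -andbA andbC -andbA.
Qed.

Lemma pderiv3 x E S : E \subset complete_edges V -> #|S| = 3%N ->
  pderiv x E S = (S \in E)%:R.
Proof.
move=> /subsetP Ec S3; rewrite /pderiv.
have P e : (e \in E) && (S \subset e) -> e = S.
  case/andP => /Ec /complete_edges_card3 e3 Se.
  by apply/esym/eqP; rewrite eqEcard Se e3 S3.
case: (boolP (S \in E)) => SE.
  rewrite (big_pred1 S) ?setDv ?big_set0 // => e /=.
  by apply/idP/eqP => [/P//|->]; rewrite SE subxx.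
by rewrite big_pred0 // => e; apply: contraNF SE => h; rewrite -(P _ h); case/andP: h.
Qed.

Lemma prod_transfer x i j d e : i != j ->
  \prod_(k in e) transfer x i j d k = \prod_(k in e) x k +
   d * ((i \in e)%:R * \prod_(k in e :\ i) x k - (j \in e)%:R * \prod_(k in e :\ j) x k)
   - d ^+ 2 * (([set i; j] \subset e)%:R * \prod_(k in e :\: [set i; j]) x k).
Proof.
move=> ij.
have off S : i \notin S -> j \notin S ->
    \prod_(k in S) transfer x i j d k = \prod_(k in S) x k.
  move=> iS jS; apply: eq_bigr => k kS; rewrite /transfer.
  have /negPf -> : k != i by apply: contraNneq iS => <-.
  have /negPf -> : k != j by apply: contraNneq jS => <-.
  by rewrite subrr mulr0 addr0.
have si : transfer x i j d i = x i + d by rewrite /transfer eqxx (negPf ij) subr0 mulr1.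
have sj : transfer x i j d j = x j - d.
  by rewrite /transfer eqxx eq_sym (negPf ij) sub0r mulrN1.
have D1 (f : V -> R) (A : {set V}) k : k \in A ->
    \prod_(l in A) f l = f k * \prod_(l in A :\ k) f l by move=> kA; rewrite (big_setD1 k).
rewrite subUset !sub1set.
case: (boolP (i \in e)) => ie; case: (boolP (j \in e)) => je /=.
- have jei : j \in e :\ i by rewrite !inE eq_sym ij.
  have iej : i \in e :\ j by rewrite !inE ij.
  have eq2 : e :\: [set i; j] = e :\ i :\ j by rewrite setDDl.
  have eq3 : e :\ j :\ i = e :\ i :\ j by rewrite !setDDl setUC.
  rewrite (D1 _ _ _ ie) (D1 _ _ _ jei) off ?inE ?eqxx ?andbF //.
  rewrite (D1 _ e _ ie) !(D1 _ _ _ jei) (D1 _ _ _ iej) eq2 eq3 si sj; ring.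
- rewrite (D1 _ _ _ ie) off ?inE ?eqxx ?(negPf je) ?andbF //.
  rewrite (D1 _ e _ ie) si; ring.
- rewrite (D1 _ _ _ je) off ?inE ?eqxx ?(negPf ie) ?andbF //.
  rewrite (D1 _ e _ je) sj; ring.
- rewrite off //; ring.
Qed.

(** Exact Taylor expansion: the polynomial is affine in each single weight, so the mixed derivative
    is the only second order term. *)
Lemma wpoly_transfer x E i j d : i != j ->
  wpoly (transfer x i j d) E = wpoly x E +
    d * (pderiv x E [set i] - pderiv x E [set j]) - d ^+ 2 * pderiv x E [set i; j].
Proof.
move=> ij; rewrite /wpoly /pderiv !big_mkcondr /=.
rewrite -sumrB !big_distrr /= -big_split -sumrB /=; apply: eq_bigr => e _.
rewrite prod_transfer // !sub1set.
by do 3! case: ifP => _; rewrite ?(mul1r, mul0r).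
Qed.

Lemma pderiv_ge0 x E S : (forall i, 0 <= x i) -> 0 <= pderiv x E S.
Proof. by move=> x0; apply: sumr_ge0 => e _; apply: prodr_ge0. Qed.

Lemma pderivD x E S : E \subset complete_edges V ->
  pderiv x E S + pderiv x (complete_edges V :\: E) S = pderiv x (complete_edges V) S.
Proof.
move=> Ec; rewrite /pderiv !big_mkcondr /= [RHS](big_setID E) /=.
by rewrite (setIidPr Ec).
Qed.

Lemma pderiv_complete2 x a c : a != c ->
  pderiv x (complete_edges V) [set a; c] = \sum_i x i - x a - x c.
Proof.
move=> ac; have := euler x [set a; c] (subxx (complete_edges V)).
rewrite cards2 ac mul1r => <-.
rewrite [X in _ = X - _ - _](bigD1 a) //= [X in _ = _ + X - _ - _](bigD1 c) 1?eq_sym //=.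
rewrite [RHS](_ : _ = \sum_(i | (i != a) && (i != c)) x i); last by ring.
apply: eq_big => [i|i]; first by rewrite !inE negb_or.
rewrite !inE negb_or => /andP[ia ic].
have S3 : #|i |: [set a; c]| = 3%N by rewrite cardsU1 cards2 ac !inE negb_or ia ic.
by rewrite pderiv3 ?S3 // inE S3 eqxx mulr1.
Qed.

(** The right side is the square of the sum minus the sum of squares of the weights other than that
    of a, so twice their second elementary symmetric polynomial. *)
Lemma pderiv_complete1 x a :
  2 * pderiv x (complete_edges V) [set a] =
  (\sum_i x i) ^+ 2 - \sum_i x i ^+ 2 - 2 * x a * (\sum_i x i - x a).
Proof.
have := euler x [set a] (subxx (complete_edges V)).
rewrite cards1 => <-.
have e (f : V -> R) : \sum_(i | i \notin [set a]) f i = \sum_i f i - f a.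
  rewrite [X in _ = X - _](bigD1 a) //= addrAC subrr add0r.
  by apply: eq_bigl => i; rewrite inE.
rewrite (eq_bigr (fun i => x i * (\sum_k x k - x a) - x i ^+ 2)); last first.
  by move=> i; rewrite inE => ia; rewrite pderiv_complete2 //; ring.
rewrite sumrB -big_distrl /= !e; ring.
Qed.

End Polynomial.

(** * Optimal pairs and their first order conditions *)

Section Extremal.
Variables (R : realType) (V : finType) (m : nat).
Implicit Types (x y : V -> R) (E F : {set {set V}}) (e f : {set V}).

(** The competitor [F] may have fewer than m edges and may contain cliques, so that the results of
    swaps and merges are admissible. *)
Definition extremal E x : Prop :=
  [/\ E \subset complete_edges V, (#|E| <= m)%N, @simplex R V x &
      forall F y, F \subset complete_edges V -> (#|F| <= m)%N ->
        @simplex R V y -> wpoly y F <= wpoly x E].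

Lemma sum_transfer x i j d : \sum_k transfer x i j d k = \sum_k x k.
Proof.
rewrite big_split -big_distrr sumrB /=.
have e k : \sum_l ((l == k)%:R : R) = 1.
  by rewrite (bigD1 k) //= eqxx big1 ?addr0 // => l /negPf ->.
by rewrite !e subrr mulr0 addr0.
Qed.

Lemma simplex_transfer x i j d : @simplex R V x -> i != j -> 0 <= d <= x j ->
  @simplex R V (transfer x i j d).
Proof.
move=> [x0 x1] ij /andP[d0 dj]; split; last by rewrite sum_transfer.
move=> k; rewrite /transfer; case: (eqVneq k j) => [->|_].
  by rewrite eq_sym (negPf ij) sub0r mulrN1 subr_ge0.
by rewrite subr0 addr_ge0 // mulr_ge0.
Qed.

Lemma kkt E x i j : extremal E x -> 0 < x j ->
  pderiv x E [set i] <= pderiv x E [set j].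
Proof.
move=> [Ec Em xS xmax] xj; case: (eqVneq i j) => [->//|ij].
rewrite -subr_le0 leNgt; apply/negP.
set D := (_ - _) => D0.
have [x0 _] := xS.
have := pderiv_ge0 E [set i; j] x0; set H := pderiv _ _ _ => H0.
(* The 1 covers the case H = 0 and leaves D - d H >= d, so the gain d D - d^2 H is positive. *)
pose d := Num.min (x j) (D / (H + 1)).
have d0 : 0 < d by rewrite lt_min xj divr_gt0 // ltr_wpDl.
have dj : d <= x j by rewrite ge_min lexx.
have dD : d * (H + 1) <= D by rewrite -ler_pdivlMr ?ge_min ?lexx ?orbT // ltr_wpDl.
have := xmax E _ Ec Em (simplex_transfer xS ij (introT andP (conj (ltW d0) dj))).
rewrite wpoly_transfer // -/D -/H; nra.
Qed.

(** On full support [kkt] holds in both directions, so all derivatives agree; Euler's identity gives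
    their weighted mean. *)
Lemma kkt_eq E x i : extremal E x -> (forall k, 0 < x k) ->
  pderiv x E [set i] = 3 * wpoly x E.
Proof.
move=> xE xp; have [Ec _ [_ x1] _] := xE.
have := euler x set0 Ec; rewrite cards0 pderiv0 => <-.
rewrite -[LHS]mul1r -x1 big_distrl /=.
apply: eq_big => [k|k _]; first by rewrite inE.
by rewrite setU0; congr (_ * _); apply/eqP; rewrite eq_le !(kkt _ xE).
Qed.

Lemma wpolyU x E F : [disjoint E & F] -> wpoly x (E :|: F) = wpoly x E + wpoly x F.
Proof.
move=> d; rewrite /wpoly -bigU //; apply: eq_bigl => e.
by rewrite !inE.
Qed.

(* An equally heavy non-edge could be swapped in; both triple systems would then
   satisfy the first order conditions at x, although the derivative at a vertex
   of the new edge has increased. *)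
Lemma threshold E x e f : extremal E x -> (forall k, 0 < x k) ->
  e \in E -> f \notin E -> #|f| = 3%N ->
  \prod_(i in f) x i < \prod_(i in e) x i.
Proof.
move=> xE xp eE fE f3; have [Ec Em xS xmax] := xE.
rewrite ltNge; apply/negP => ef.
pose E' := f |: (E :\ e).
have fEe : f \notin E :\ e by rewrite inE (negPf fE) andbF.
have E'c : E' \subset complete_edges V.
  rewrite subUset sub1set inE f3 eqxx /=.
  exact: subset_trans (subsetDl _ _) Ec.
have E'm : (#|E'| <= m)%N.
  by rewrite cardsU1 fEe; move: Em; rewrite (cardsD1 e E) eE.
have wE' : wpoly x E' = wpoly x E + (\prod_(i in f) x i - \prod_(i in e) x i).
  rewrite /wpoly big_setU1 //= [in RHS](big_setD1 e) //=; ring.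
have eq0 : \prod_(i in f) x i = \prod_(i in e) x i.
  apply/eqP; rewrite eq_le ef andbT -subr_le0.
  by have := xmax _ _ E'c E'm xS; rewrite wE' gerDl.
have xE' : extremal E' x.
  split=> // F y Fc Fm yS; rewrite wE' eq0 subrr addr0; exact: xmax.
have ne : ~~ (f \subset e).
  apply/negP => fe; move: fE; suff -> : f = e by rewrite eE.
  apply/eqP; rewrite eqEcard fe f3 /=.
  have /subsetP/(_ e eE) := Ec; rewrite inE => /eqP ->//.
have [i iff ie] := subsetPn ne.
have := kkt_eq i xE xp; have := kkt_eq i xE' xp.
rewrite wE' eq0 subrr addr0 => <- /eqP; apply/negP.
rewrite lt_eqF // /pderiv.
rewrite [X in X < _](_ : _ = \sum_(g in E :\ e | [set i] \subset g) \prod_(k in g :\: [set i]) x k).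
  rewrite !big_mkcondr /= big_setU1 //= sub1set iff ltrDr.
  by apply: prodr_gt0.
apply: eq_bigl => g; rewrite !inE sub1set.
by case: (eqVneq g e) => //= ->; rewrite (negPf ie) andbF.
Qed.

(** A spare place would be filled by f, which has positive weight. *)
Lemma nonedge_card E x f : extremal E x -> (forall k, 0 < x k) ->
  f \notin E -> #|f| = 3%N -> #|E| = m.
Proof.
move=> [Ec Em xS xmax] xp fE f3; apply/eqP; rewrite eqn_leq Em leqNgt /=.
apply/negP => lt.
have := xmax (f |: E) x; rewrite subUset sub1set inE f3 eqxx Ec => /(_ isT).
rewrite cardsU1 fE => /(_ lt xS); rewrite /wpoly big_setU1 //= gerDr.
by rewrite leNgt prodr_gt0.
Qed.

Lemma wpoly_merge E x i j : i != j ->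
  pderiv x E [set i] = pderiv x E [set j] ->
  wpoly (transfer x i j (x j)) E = wpoly x E - x j ^+ 2 * pderiv x E [set i; j].
Proof. by move=> ij e; rewrite wpoly_transfer // e subrr mulr0 addr0. Qed.

(** The first order condition in terms of the non-edges, by subtraction from the complete system. *)
Lemma kkt_compl E x a : extremal E x -> (forall k, 0 < x k) ->
  2 * pderiv x (complete_edges V :\: E) [set a] =
  1 - \sum_i x i ^+ 2 - 2 * x a * (1 - x a) - 6 * wpoly x E.
Proof.
move=> xE xp; have [Ec _ [_ x1] _] := xE.
have := pderiv_complete1 x a; rewrite x1 -(pderivD x _ Ec) (kkt_eq _ xE xp).
move=> h; lra.
Qed.

End Extremal.

(** * Supports of at most t vertices *)

Section Cases.
Variables (R : realType) (V : finType).
Implicit Types (x y : V -> R) (E F : {set {set V}}) (e f : {set V}).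

Lemma card3_pick e i : #|e| = 3%N -> i \in e ->
  exists a c, [/\ a != c, a != i, c != i & e :\ i = [set a; c]].
Proof.
move=> e3 ie.
have : #|e :\ i| == 2%N by move: e3; rewrite (cardsD1 i e) ie add1n => -[->].
case/cards2P => a [c] [ac eq]; exists a, c; split=> //.
  by have /setD1P[] : a \in e :\ i by rewrite eq !inE eqxx.
by have /setD1P[] : c \in e :\ i by rewrite eq !inE eqxx orbT.
Qed.

(** Sum [kkt_compl] over all vertices and bound the sum of squares below by 1 / |V| (Cauchy-Schwarz,
    [kQ]). *)
Lemma wpoly_le m E x : (0 < #|E|)%N -> extremal m E x -> (forall k, 0 < x k) ->
  6 * #|V|%:R ^+ 2 * wpoly x E +
  2 * #|V|%:R * \sum_a pderiv x (complete_edges V :\: E) [set a] <=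
  (#|V|%:R - 1) * (#|V|%:R - 2).
Proof.
move=> /card_gt0P[e eE] xE xp; have [/subsetP Ec _ [x0 x1] _] := xE.
have : (3 <= #|V|)%N.
  by rewrite -(card_triple (Ec _ eE)) max_card.
rewrite -(ler_nat R); set k := #|V|%:R => k3.
have sk (c : R) : \sum_(i : V) c = k * c by rewrite sumr_const mulr_natl.
set Q := \sum_i x i ^+ 2; set D := \sum_a _.
have sum_kkt : 2 * D = k * (1 - Q - 6 * wpoly x E) - 2 + 2 * Q.
  rewrite /D big_distrr /=.
  rewrite (eq_bigr (fun a => 1 - Q - 6 * wpoly x E - 2 * x a + 2 * x a ^+ 2)).
    by rewrite big_split sumrB /= -!big_distrr /= x1 sk mulr1.
  by move=> a _; rewrite (kkt_compl a xE xp) -/Q; ring.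
have kQ : 0 <= k * Q - 1.
  rewrite -(pmulr_rge0 _ (_ : 0 < k)); last by lra.
  have -> : k * (k * Q - 1) = \sum_i (k * x i - 1) ^+ 2.
    rewrite (eq_bigr (fun i => k ^+ 2 * x i ^+ 2 - 2 * k * x i + 1)); last by move=> i _; ring.
    rewrite big_split sumrB /= -!big_distrr /= x1 sk -/Q; ring.
  by apply: sumr_ge0 => i _; exact: sqr_ge0.
have := congr1 (fun z => k * z) sum_kkt; nra.
Qed.

(* The Lagrangian of the complete 3-graph on t vertices. *)
Definition clique_value (t : nat) : R := (t%:R - 1) * (t%:R - 2) / (6 * t%:R ^+ 2).

Lemma le_clique_value t (p : R) : (0 < t)%N ->
  (p <= clique_value t) = (6 * t%:R ^+ 2 * p <= (t%:R - 1) * (t%:R - 2)).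
Proof.
move=> t0; have h : 0 < 6 * t%:R ^+ 2 :> R by rewrite mulr_gt0 // exprn_gt0 // ltr0n.
by rewrite /clique_value ler_pdivlMr // (mulrC p).
Qed.

Lemma clique_value_le t (p : R) : (0 < t)%N ->
  (clique_value t <= p) = ((t%:R - 1) * (t%:R - 2) <= 6 * t%:R ^+ 2 * p).
Proof.
move=> t0; have h : 0 < 6 * t%:R ^+ 2 :> R by rewrite mulr_gt0 // exprn_gt0 // ltr0n.
by rewrite /clique_value ler_pdivrMr // (mulrC p).
Qed.

Lemma clique_value_gt0 t : (3 <= t)%N -> 0 < clique_value t.
Proof.
rewrite -(ler_nat R) => t3; rewrite divr_gt0 //; first by rewrite mulr_gt0; lra.
by rewrite mulr_gt0 // exprn_gt0 //; lra.
Qed.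

Lemma wpoly_gt0 E x : 0 < wpoly x E -> (0 < #|E|)%N.
Proof.
by apply: contraTT; rewrite -eqn0Ngt cards_eq0 => /eqP ->; rewrite /wpoly big_set0 ltxx.
Qed.

(** By [wpoly_le] the value is at most [clique_value] at |V|, which increases strictly from 3 on. At
    |V| = t a missing triple would make the non-edge sum positive and the bound strict. *)
Lemma extremal_small m t E x : (3 <= t)%N -> (#|V| <= t)%N ->
  extremal m E x -> (forall k, 0 < x k) -> clique_value t <= wpoly x E ->
  [/\ wpoly x E <= clique_value t, #|V| = t & complete_edges V \subset E].
Proof.
move=> t3 Vt xE xp tE; have [/subsetP Ec _ [x0 x1] _] := xE.
have t0 : (0 < t)%N by apply: leq_trans t3.
have E0 : (0 < #|E|)%N by apply: (@wpoly_gt0 E x); exact: lt_le_trans (clique_value_gt0 t3) tE.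
have D0 : 0 <= \sum_a pderiv x (complete_edges V :\: E) [set a].
  by apply: sumr_ge0 => a _; exact: pderiv_ge0.
have := wpoly_le E0 xE xp.
have V3 : (3 <= #|V|)%N.
  by have /card_gt0P[e eE] := E0; rewrite -(card_triple (Ec _ eE)) max_card.
have Vt_eq : #|V| = t.
  apply/eqP; rewrite eqn_leq Vt leqNgt /=; apply/negP => Vlt.
  have := wpoly_le E0 xE xp; move: tE; rewrite clique_value_le //.
  move: Vlt t3 V3; rewrite -(ltr_nat R) -!(ler_nat R).
  set k := #|V|%:R; set T := t%:R; set p := wpoly _ _; set D := (\sum_a _) in D0 *.
  move=> kT T3 k3 pT pk.
  have pk' : 6 * k ^+ 2 * p <= (k - 1) * (k - 2) by nra.
  have h1 : k ^+ 2 * ((T - 1) * (T - 2)) <= T ^+ 2 * ((k - 1) * (k - 2)).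
    apply: (le_trans (ler_wpM2l (sqr_ge0 _) pT)).
    apply: le_trans (ler_wpM2l (sqr_ge0 T) pk'); rewrite le_eqVlt; apply/orP; left; apply/eqP; ring.
  (* This product is k^2 (T - 1)(T - 2) - T^2 (k - 1)(k - 2). *)
  suff : 0 < (T - k) * (3 * T * k - 2 * (T + k)) by nra.
  by rewrite mulr_gt0 ?subr_gt0 //; nra.
rewrite Vt_eq => wle; split=> //.
  have kk : 0 <= 2 * t%:R * \sum_a pderiv x (complete_edges V :\: E) [set a].
    by rewrite !mulr_ge0.
  by rewrite le_clique_value //; lra.
apply/subsetP => f fc; rewrite -[_ \in E]negbK; apply/negP => fE.
move: tE; rewrite clique_value_le // => tE.
have /card_gt0P[i fi] : (0 < #|f|)%N by rewrite (card_triple fc).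
have : 0 < \sum_a pderiv x (complete_edges V :\: E) [set a].
  rewrite (bigD1 i) //= ltr_pwDl //; last first.
    by apply: sumr_ge0 => a _; exact: pderiv_ge0.
  rewrite /pderiv (bigD1 f) /=; last by rewrite inE fE fc sub1set.
  rewrite ltr_pwDl // ?prodr_gt0 //.
  by apply: sumr_ge0 => e _; exact: prodr_ge0.
move=> DD; have : 0 < 2 * t%:R * \sum_a pderiv x (complete_edges V :\: E) [set a].
  by rewrite !mulr_gt0 // ltr0n.
lra.
Qed.

End Cases.

(** * Supports of t + 1 vertices with a t-clique *)

Section Cases.
Variables (R : realType) (V : finType).
Implicit Types (x y : V -> R) (E F : {set {set V}}) (e f : {set V}).

(** The first two terms are the edge bound, so a system attaining it on t + 1 vertices misses t - 1
    triples. *)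
Lemma binS3 t : ('C(t.+1, 3) = 'C(t, 3) + 'C(t.-1, 2) + t.-1)%N.
Proof. by case: t => [|t] //; rewrite binS [X in (_ + X)%N]binS bin1 addnA. Qed.

Lemma sum_card2 (e : {set V}) a c (F : V -> R) : a != c -> e = [set a; c] ->
  \sum_(i in e) F i = F a + F c.
Proof. by move=> ac ->; rewrite big_setU1 ?inE //= big_set1. Qed.

(* Only one edge of the link of z contains both ends a, c of a given one, so
   [d a + d c <= #|N| + 1]; sum this over the edges of the link. *)
Lemma sum_degree_le (N : {set {set V}}) z : N \subset complete_edges V ->
  (forall n, n \in N -> z \in n) ->
  \sum_(c | c != z) (#|[set n in N | c \in n]|%:R : R) ^+ 2 <= #|N|%:R * (#|N|%:R + 1).
Proof.
move=> /subsetP Nc zN; pose d c := #|[set n in N | c \in n]|.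
have -> : \sum_(c | c != z) (#|[set n in N | c \in n]|%:R : R) ^+ 2 =
    \sum_(n in N) \sum_(c in n :\ z) (d c)%:R.
  rewrite (exchange_big_dep (fun c => c != z)) /=; last first.
    by move=> n c _; rewrite !inE => /andP[].
  apply: eq_bigr => c cz; rewrite sumr_const expr2 -[RHS]mulr_natr; congr (_ * _%:R).
  by apply: eq_card => n; rewrite inE [RHS]unfold_in /= in_setD1 cz.
rewrite mulr_natl -sumr_const; apply: ler_sum => n nN.
have [a [c [ac az cz eq]]] := card3_pick (card_triple (Nc _ nN)) (zN _ nN).
rewrite (sum_card2 _ ac eq) -natrD natr1 ler_nat /d.
rewrite -cardsUI -addn1 leq_add //.
  by apply: subset_leq_card; apply/subsetP => k; rewrite !inE => /orP[] /andP[].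
rewrite -(cards1 n); apply: subset_leq_card; apply/subsetP => k.
rewrite !inE => /andP[/andP[kN ak] /andP[_ ck]].
rewrite eq_sym eqEcard (card_triple (Nc _ nN)) (card_triple (Nc _ kN)) leqnn andbT.
apply/subsetP => i; case: (eqVneq i z) => [->|iz]; first by move=> _; exact: zN.
move=> i_n; have : i \in n :\ z by rewrite !inE iz.
by rewrite eq !inE => /orP[] /eqP ->.
Qed.

(** Both sides add up, over n in N, the weights of the two vertices of n other than z. *)
Lemma sum_degree (N : {set {set V}}) z x : N \subset complete_edges V ->
  (forall n, n \in N -> z \in n) ->
  \sum_(c | c != z) #|[set n in N | c \in n]|%:R * x c =
  \sum_(a | a != z) pderiv x N [set a; z].
Proof.
move=> /subsetP Nc zN; rewrite /pderiv.
rewrite (exchange_big_dep (mem N)) /=; last by move=> a n _ /andP[].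
under eq_bigr => c _ do rewrite mulr_natl -sumr_const.
rewrite (exchange_big_dep (mem N)) /=; last by move=> c n _; rewrite inE => /andP[].
apply: eq_bigr => n nN.
have [a [c [ac az cz eq]]] := card3_pick (card_triple (Nc _ nN)) (zN _ nN).
rewrite (eq_bigl (mem (n :\ z))) /=; last by move=> i; rewrite !inE nN.
rewrite [RHS](eq_bigl (mem (n :\ z))) /=; last first.
  by move=> i; rewrite !inE nN subUset !sub1set (zN _ nN) andbT.
rewrite !(sum_card2 _ ac eq) ![[set _; z]]setUC -!setDDl eq.
have -> : [set a; c] :\ a = [set c].
  by apply/setP => i; rewrite !inE; case: (eqVneq i a) => //= ->; rewrite (negPf ac).
have -> : [set a; c] :\ c = [set a].
  by apply/setP => i; rewrite !inE; case: (eqVneq i c) => //= [->|]; rewrite ?orbF // eq_sym (negPf ac).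
by rewrite !big_set1 addrC.
Qed.

(* The weights x outside z and the degrees d in the link of z of the non-edges
   enter through the square [sq]; with the first order conditions summed over
   the vertices other than z, this is an equality when both are constant. *)
Lemma extremal_clique_succ t E x (K : {set V}) : (3 <= t)%N -> #|V| = t.+1 ->
  extremal ('C(t, 3) + 'C(t.-1, 2)) E x -> (forall k, 0 < x k) ->
  #|K| = t -> (forall e, e \subset K -> #|e| = 3%N -> e \in E) ->
  wpoly x E <= clique_value R t.
Proof.
move=> t3 Vt xE xp Kt KE; have [Ec Em [x0 x1] _] := xE.
pose N := complete_edges V :\: E.
have Nc : N \subset complete_edges V := subsetDl _ _.
have [z zK] : exists z, ~: K = [set z].
  by apply/cards1P; have := cardsC K; rewrite Kt Vt => /eqP; rewrite -addn1 eqn_add2l.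
have zN n : n \in N -> z \in n.
  rewrite inE => /andP[nE nc]; apply: contraR nE => zn; apply: KE.
    apply/subsetP => i i_n; rewrite -[_ \in K]negbK -in_setC zK inE.
    by apply: contraNneq zn => <-.
  exact: card_triple.
(* The edge bound is below the number of triples, so a non-edge exists and [nonedge_card] makes the
   bound an equality. *)
have cN : #|N| = t.-1.
  have cc : #|complete_edges V| = ('C(t, 3) + 'C(t.-1, 2) + t.-1)%N.
    by rewrite /complete_edges card_draws Vt binS3.
  have [f fN] : exists f, f \in N.
    apply/card_gt0P; rewrite cardsD (setIidPr Ec) cc subn_gt0.
    by rewrite (leq_ltn_trans Em) // -addn1 leq_add2l -ltnS prednK; apply: leq_trans t3.
  have [fE fc] : f \notin E /\ f \in complete_edges V by move: fN; rewrite inE => /andP[].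
  have Eeq := nonedge_card xE xp fE (card_triple fc).
  by rewrite cardsD (setIidPr Ec) cc Eeq addKn.
have t0 : (0 < t)%N by apply: leq_trans t3.
rewrite le_clique_value //; set T := t%:R.
have cNT : #|N|%:R = T - 1 :> R by rewrite cN -subn1 natrB.
pose d c : R := #|[set n in N | c \in n]|%:R.
have d2 : \sum_(c | c != z) d c ^+ 2 <= T * (T - 1).
  by have := sum_degree_le Nc zN; rewrite cNT => h; apply: le_trans h _; rewrite le_eqVlt; apply/orP; left; apply/eqP; ring.
have pz a : a != z -> pderiv x N [set a] = x z * pderiv x N [set a; z].
  move=> az; rewrite /pderiv big_distrr /=.
  apply: eq_big => n.
    by rewrite subUset !sub1set; case: (boolP (n \in N)) => //= /zN ->; rewrite andbT.
  case/andP=> /zN zn _; rewrite (big_setD1 z) /= ?setDDl //.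
  by rewrite !inE zn eq_sym az.
pose D := \sum_(c | c != z) d c * x c.
have D1 : \sum_(c | c != z) d c = 2 * (T - 1).
  have -> : \sum_(c | c != z) d c = \sum_(c | c != z) d c * (fun=> 1) c.
    by apply: eq_bigr => c _; rewrite mulr1.
  rewrite (sum_degree _ Nc zN).
  have := euler (fun=> 1 : R) [set z] Nc; rewrite cards1 pderiv1.
  have -> : [set n in N | [set z] \subset n] = N.
    by apply/setP => n; rewrite inE sub1set; case: (boolP (n \in N)) => //= /zN.
  rewrite cNT => <-; apply: eq_big => [c|c _]; first by rewrite inE.
  by rewrite mul1r.
have DE : D = \sum_(a | a != z) pderiv x N [set a; z] := sum_degree x Nc zN.
pose Q := \sum_(i | i != z) x i ^+ 2.
have sumx : \sum_(i | i != z) x i = 1 - x z by rewrite -x1 [X in _ = X - _](bigD1 z) //= addrAC subrr add0r.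
have sk (c : R) : \sum_(i : V | i != z) c = T * c.
  rewrite sumr_const mulr_natl; congr (_ *+ _); rewrite -Kt; apply: eq_card => i.
  by rewrite -[i \in K]negbK -in_setC zK !inE.
have kkt_sum : 2 * x z * D =
    T * (1 - (Q + x z ^+ 2)) - 2 * (1 - x z - Q) - 6 * T * wpoly x E.
  rewrite DE big_distrr /=; set p := wpoly x E.
  rewrite (eq_bigr (fun a => (1 - (Q + x z ^+ 2) - 6 * p) - 2 * x a + 2 * x a ^+ 2)).
    by rewrite big_split sumrB /= -!big_distrr /= sumx sk -/Q; ring.
  move=> a az; rewrite -mulrA -pz // (kkt_compl a xE xp) (bigD1 z) //= -/Q -/p; ring.
(* The mean over c != z of the linear form squared in [sq]. *)
pose B := T - 2 + x z * T.
have sq : 0 <= \sum_(c | c != z) ((T - 2) * T * x c + x z * T * d c - B) ^+ 2.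
  by apply: sumr_ge0 => c _; exact: sqr_ge0.
have sqE : \sum_(c | c != z) ((T - 2) * T * x c + x z * T * d c - B) ^+ 2 =
    (T - 2) ^+ 2 * T ^+ 2 * Q + x z ^+ 2 * T ^+ 2 * (\sum_(c | c != z) d c ^+ 2)
    + 2 * (T - 2) * T ^+ 2 * x z * D - T * B ^+ 2.
  rewrite (eq_bigr (fun c => (T - 2) ^+ 2 * T ^+ 2 * x c ^+ 2
     + x z ^+ 2 * T ^+ 2 * d c ^+ 2 + 2 * (T - 2) * T ^+ 2 * x z * (d c * x c)
     - 2 * B * (T - 2) * T * x c - 2 * B * x z * T * d c + B ^+ 2)); last first.
    by move=> c _; ring.
  have lin (k : R) (f : V -> R) : \sum_(c | c != z) k * f c = k * \sum_(c | c != z) f c.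
    by rewrite big_distrr.
  rewrite !(sumrB, big_split) /= !lin sumx sk D1 -/Q -/D /B; ring.
have T3 : 3 <= T by rewrite (ler_nat _ 3).
have TT : 0 < (T - 2) * T.
  by clear -T3; apply: mulr_gt0; lra.
(* Multiplied by (T - 2) T, the claim is exactly the sum of [sq] and [hD]. *)
rewrite -[_ <= _]subr_ge0 -(pmulr_rge0 _ TT).
rewrite sqE in sq.
have := ler_wpM2l (mulr_ge0 (sqr_ge0 (x z)) (sqr_ge0 T)) d2.
set Delta := \sum_(c | _) d c ^+ 2 in sq *; move=> hD.
have -> : 6 * T ^+ 2 * wpoly x E = T * (6 * T * wpoly x E) by ring.
have -> : 6 * T * wpoly x E = T * (1 - (Q + x z ^+ 2)) - 2 * (1 - x z - Q) - 2 * x z * D.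
  by rewrite kkt_sum; ring.
rewrite /B in sq; nra.
Qed.

End Cases.

(** * Supports of at least t + 2 vertices *)

Section LargeSupport.
Variables (R : realType) (V : finType).
Implicit Types (x y : V -> R) (E F : {set {set V}}) (e f : {set V}).

(** Discarding a lightest element does not lower the average; repeat until k elements remain. *)
Lemma exists_heavy_subset (I : finType) (w : I -> R) (C : {set I}) k :
  (forall i, 0 <= w i) -> (k <= #|C|)%N ->
  exists D : {set I}, [/\ D \subset C, #|D| = k &
    k%:R * \sum_(i in C) w i <= #|C|%:R * \sum_(i in D) w i].
Proof.
move=> w0; have [r] := ubnP (#|C| - k); elim: r C => // r IH C.
rewrite ltnS => Cr; rewrite leq_eqVlt => /orP[/eqP ->|kC].
  by exists C; split.
have /card_gt0P[i0 i0C] : (0 < #|C|)%N by apply: leq_trans kC.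
have [i iC imin] : exists2 i, i \in C & forall j, j \in C -> w i <= w j.
  by case: (@arg_minP _ _ _ i0 (mem C) w i0C) => i iC imin; exists i.
have cC : #|C| = #|C :\ i|.+1 by rewrite (cardsD1 i C) iC.
have [||D [DC Dk Dw]] := IH (C :\ i).
- by move: Cr kC; rewrite cC; lia.
- by move: kC; rewrite cC.
exists D; split=> //; first exact: subset_trans DC (subsetDl _ _).
have k0 : 0 <= k%:R :> R by [].
have D0 : 0 <= \sum_(i in D) w i by apply: sumr_ge0.
have wi : #|C :\ i|%:R * w i <= \sum_(j in C :\ i) w j.
  by rewrite mulr_natl -sumr_const; apply: ler_sum => j /setD1P[_]; exact: imin.
case: (posnP #|C :\ i|) => [c0|c0].
  have -> : k = 0%N by move: kC; rewrite cC c0; lia.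
  by rewrite mul0r mulr_ge0.
rewrite (big_setD1 i) //= cC -natr1.
have {}c0 : 0 < #|C :\ i|%:R :> R by rewrite ltr0n.
rewrite -(ler_pM2l c0).
set c := #|_|%:R in Dw wi c0 *; set s := \sum_(_ in C :\ i) _ in Dw wi *.
set d := \sum_(_ in D) _ in Dw D0 *.
have := ler_wpM2l k0 wi; have := mulr_ge0 (ltW c0) D0; nra.
Qed.

Lemma card_link_le (M : {set {set V}}) a (A : {set V}) :
  M \subset complete_edges V -> (forall n, n \in M -> a \in n) ->
  (forall n, n \in M -> n :\ a \subset A) -> (#|M| <= 'C(#|A|, 2))%N.
Proof.
move=> /subsetP Mc Ma MA.
rewrite -(cards_draws A 2) -(@card_in_imset _ _ (fun n => n :\ a) M); last first.
  by move=> n k nM kM /= e; rewrite -(setD1K (Ma _ nM)) e setD1K ?Ma.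
apply: subset_leq_card; apply/subsetP => _ /imsetP[n nM ->].
by rewrite inE MA //= -eqSS -(card_triple (Mc _ nM)) (cardsD1 a n) Ma.
Qed.

Lemma card_complete_avoid (v : V) :
  #|[set e in complete_edges V | v \notin e]| = 'C(#|V|.-1, 3).
Proof.
rewrite -(cardsC1 v) -cards_draws; apply: eq_card => e.
by rewrite !inE subsetC sub1set inE andbC.
Qed.

Lemma pderiv_split x E u v : u != v ->
  pderiv x E [set u] = \sum_(n in [set n in E | (u \in n) && (v \notin n)]) \prod_(i in n :\ u) x i
    + x v * pderiv x E [set u; v].
Proof.
move=> uv; rewrite /pderiv (bigID (fun n : {set V} => v \in n)) /= addrC; congr (_ + _).
  by apply: eq_bigl => n; rewrite !inE sub1set andbA.
rewrite big_distrr /=; apply: eq_big => n.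
  by rewrite subUset !sub1set andbA.
case/andP => _ vn; rewrite (big_setD1 v) /= ?setDDl //.
by rewrite !inE vn eq_sym uv.
Qed.

Lemma prod_triple x i a c : i \notin [set a; c] -> a != c ->
  \prod_(k in i |: [set a; c]) x k = x i * (x a * x c).
Proof.
by move=> ni ac; rewrite big_setU1 //= big_setU1 ?inE //= big_set1.
Qed.

(** The real arithmetic of [extremal_large]: n = b + q is |V| - 2, q counts the vertices outside B,
    u, v, f the edges at v, and c the non-edges containing u but not v, whose derivative at u is s.
    The disjunction bounds s; the last equation, the difference of the first order conditions on B
    and at u, then bounds X. *)
Lemma large_support_bound (X xu xv s b q n f c : R) :
  1 <= b -> 2 <= q -> 4 <= n -> n = b + q -> 0 < xv -> xv <= xu -> 0 < X ->
  b * (n + q + 1) <= 2 * f -> 2 * c <= q * (q - 1) ->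
  ((xu + xv) * s <= b * X * xv ^+ 2 \/ f * ((xu + xv) * s) <= c * (b * X * xv ^+ 2)) ->
  n * xv <= 1 - X - xu -> 0 <= s ->
  (X - xu) * (1 - X - xu) = s + xv * (1 - xu - xv - b * X) ->
  3 * X <= 4 * (xu + xv).
Proof.
move=> b1 q2 n4 nE xv0 xuv X0 hf hc hs hT s0 kkt.
have b0 : 0 < b by lra.
have n0 : 0 < n by lra.
have Xv0 : 0 < X * xv by rewrite mulr_gt0.
have w2 : 2 * xv * s <= (xu + xv) * s by rewrite ler_wpM2r //; lra.
have hs' : 4 * s - 4 * (b - 1) * (X * xv) <= (n - 2) * (X * xv).
  case: hs => hs.
    have : 2 * s <= b * (X * xv) by rewrite -(ler_pM2l xv0); nra.
    have : 0 <= (b - 1) * (X * xv) by rewrite mulr_ge0 ?subr_ge0 // ltW.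
    nra.
  have f0 : 0 < f by nra.
  have e1 : 2 * f * s <= c * (b * (X * xv)).
    have : f * (2 * xv * s) <= c * (b * X * xv ^+ 2).
      by apply: le_trans hs; rewrite ler_pM2l.
    by rewrite -(ler_pM2l xv0); nra.
  have e2 : b * (n + q + 1) * s <= 2 * f * s by rewrite ler_wpM2r.
  have e3 : 2 * c * (b * (X * xv)) <= q * (q - 1) * (b * (X * xv)).
    by rewrite ler_wpM2r // ltW // mulr_gt0.
  have e4 : 2 * (n + q + 1) * s <= q * (q - 1) * (X * xv).
    by rewrite -(ler_pM2l b0); nra.
  have e5 : 4 * q * s <= 2 * (n + q + 1) * s by rewrite ler_wpM2r //; lra.
  have e6 : 4 * s <= (q - 1) * (X * xv).
    have q0 : 0 < q by lra.
    by rewrite -(ler_pM2l q0); nra.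
  have : 0 <= (b - 1) * (X * xv) by rewrite mulr_ge0 ?subr_ge0 // ltW.
  have : (q - 1) * (X * xv) <= (n - 2) * (X * xv) by apply: ler_wpM2r; [exact: ltW | lra].
  lra.
case: (leP X (xu + xv)) => [|XX]; first by lra.
have XX0 : 0 < X - xu - xv by lra.
(* By the last hypothesis, (X - xu - xv)(1 - X - xu) = s - (b - 1) X xv - xv^2, to which [hs']
   applies. *)
have k1 : 4 * (X - xu - xv) * (1 - X - xu) <= (n - 2) * (X * xv).
  have : 0 <= xv ^+ 2 by exact: sqr_ge0.
  nra.
have k2 : 4 * (X - xu - xv) * (n * xv) <= 4 * (X - xu - xv) * (1 - X - xu).
  by rewrite ler_wpM2l //; lra.
have k3 : 4 * (X - xu - xv) * n <= (n - 2) * X by rewrite -(ler_pM2l xv0); nra.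
have : 4 * (X - xu - xv) <= X by rewrite -(ler_pM2l n0); nra.
lra.
Qed.

(* Let u, v be two lightest vertices and B the set of i with [iuv] an edge. By
   the threshold property all pairs are in the link of i for i in B, so x has a
   constant value X on B. Merging v into u costs [#|B| X (x v)^2] and frees the f
   edges at v for non-edges avoiding v, of which there are at least f. Choosing
   non-edges through u bounds X by a multiple of [x u]; choosing any f of them
   then gains more than the cost. *)
Lemma extremal_large t E x : (4 <= t)%N -> (t.+2 <= #|V|)%N ->
  extremal ('C(t, 3) + 'C(t.-1, 2)) E x -> (forall k, 0 < x k) ->
  (forall i j, i != j -> 0 < pderiv x E [set i; j]) -> False.
Proof.
move=> t4 tV xE xp cover; have [Ec Em [x0 x1] xmax] := xE.
pose N := complete_edges V :\: E.
have Nc : N \subset complete_edges V := subsetDl _ _.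
have NE n : n \in N -> n \notin E by rewrite inE => /andP[].
have V0 : (0 < #|V|)%N by lia.
have [v _ vmin] : exists2 v, true & forall i, x v <= x i.
  have /card_gt0P[i0 _] := V0.
  by case: (@arg_minP _ _ _ i0 predT x isT) => v _ vm; exists v => // i; exact: vm.
have [u uv umin] : exists2 u, u != v & forall i, i != v -> x u <= x i.
  have /card_gt0P[i0 i0v] : (0 < #|[set~ v]|)%N by rewrite cardsC1; lia.
  have {}i0v : i0 != v by rewrite !inE in i0v.
  by case: (@arg_minP _ _ _ i0 (fun i => i != v) x i0v) => u uv um; exists u.
have min2 a c : a != c -> x u * x v <= x a * x c.
  case: (eqVneq a v) => [->|av] ac.
    by rewrite mulrC ler_wpM2l // umin // eq_sym.
  by rewrite ler_pM ?umin.
pose B := [set i | [set i; u; v] \in E].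
have BD i : i \in B -> i \notin [set u; v].
  rewrite inE => /(subsetP Ec)/card_triple; rewrite -setUA cardsU1 cards2 uv.
  by case: (i \in _).
have full i a c : i \in B -> a != c -> a != i -> c != i -> i |: [set a; c] \in E.
  move=> iB ac ai ci; apply/negPn/negP => nE.
  have ni : i \notin [set a; c] by rewrite !inE negb_or ![i == _]eq_sym ai.
  have n3 : #|i |: [set a; c]| = 3%N by rewrite cardsU1 ni cards2 ac.
  have := iB; rewrite inE -setUA => eE.
  have := threshold xE xp eE nE n3.
  rewrite !prod_triple // ?BD // ltr_pM2l // ltNge => /negP; apply; exact: min2.
have BN i n : i \in B -> n \in N -> i \notin n.
  move=> iB nN; apply/negP => i_n; have /negP := NE _ nN; apply.
  have [a [c [ac ai ci eq]]] := card3_pick (card_triple (subsetP Nc _ nN)) i_n.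
  by rewrite -(setD1K i_n) eq full.
have sumB : pderiv x E [set u; v] = \sum_(i in B) x i.
  have := euler x [set u; v] Ec; rewrite cards2 uv mul1r => <-.
  rewrite big_mkcond [RHS]big_mkcond; apply: eq_bigr => i _.
  case: ifPn => iuv; last by case: ifPn => // iB; rewrite BD in iuv.
  have i3 : #|i |: [set u; v]| = 3%N by rewrite cardsU1 iuv cards2 uv.
  rewrite pderiv3 // [i \in B]inE -setUA.
  by case: ifP; rewrite ?mulr1 ?mulr0.
have [i0 i0B] : exists i, i \in B.
  apply/set0Pn; apply/eqP => B0; have := cover u v uv.
  by rewrite sumB B0 big_set0 ltxx.
have DN0 i : i \in B -> pderiv x N [set i] = 0.
  move=> iB; rewrite /pderiv big1 // => n /andP[nN].
  by rewrite sub1set => i_n; have := BN i n iB nN; rewrite i_n.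
set X := x i0.
have neB i : i \in B -> i != u /\ i != v.
  by move=> /BD; rewrite !inE negb_or => /andP.
have BX i : i \in B -> x i = X.
  move=> iB; have := kkt_compl i xE xp; have := kkt_compl i0 xE xp.
  rewrite !DN0 // -/X; case: (eqVneq i i0) => [->//|ii0] h1 h2.
  (* The difference of the two conditions; the second factor is positive because u carries weight
     too. *)
  have h3 : (x i - X) * (1 - x i - X) = 0 by lra.
  have h4 : 0 < 1 - x i - X.
    have [iu iv] := neB i iB; have [i0u i0v] := neB i0 i0B.
    rewrite -x1 (bigD1 i) //= (bigD1 i0) 1?eq_sym //= (bigD1 u) /=; last first.
      by rewrite ![u == _]eq_sym iu.
    rewrite -/X; have := xp u.
    set r := \sum_(_ | _) _; have : 0 <= r by apply: sumr_ge0.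
    lra.
  by move/eqP: h3; rewrite mulf_eq0 (gt_eqF h4) orbF subr_eq0 => /eqP.
have {}sumB : pderiv x E [set u; v] = #|B|%:R * X.
  by rewrite sumB (eq_bigr _ BX) sumr_const mulr_natl.
pose C := [set n in N | (u \in n) && (v \notin n)].
pose s := \sum_(n in C) \prod_(i in n :\ u) x i.
have s0 : 0 <= s by apply: sumr_ge0 => n _; exact: prodr_ge0.
have kktu : (X - x u) * (1 - X - x u) = s + x v * (1 - x u - x v - #|B|%:R * X).
  have := kkt_compl i0 xE xp; have := kkt_compl u xE xp.
  rewrite (DN0 i0 i0B) -/X -/N (pderiv_split x N uv) -/C -/s.
  have := pderivD x [set u; v] Ec; rewrite pderiv_complete2 // x1 sumB -/N.
  by move=> h1 h2 h3; nra.
pose y := transfer x u v (x v).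
have ym : @simplex R V y by apply: simplex_transfer => //; rewrite x0 lexx.
have yv : y v = 0.
  by rewrite /y /transfer eqxx eq_sym (negPf uv) sub0r mulrN1 subrr.
have yu : y u = x u + x v.
  by rewrite /y /transfer eqxx (negPf uv) subr0 mulr1.
have yo i : i != u -> i != v -> y i = x i.
  by move=> iu iv; rewrite /y /transfer (negPf iu) (negPf iv) subrr mulr0 addr0.
pose f := #|[set e in E | v \in e]|.
(* Replacing the f edges at v by F does not raise the number of edges, so optimality bounds the gain
   from F by the cost of the merge. *)
have merge F : F \subset N -> (forall n, n \in F -> v \notin n) -> (#|F| <= f)%N ->
    wpoly y F <= #|B|%:R * X * x v ^+ 2.
  move=> FN Fv Ff; pose E' := [set e in E | v \notin e].
  have dis : [disjoint E' & F].
    rewrite -setI_eq0; apply/eqP/setP => e; rewrite !inE; apply/negP.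
    by move=> /andP[/andP[eE _] /(subsetP FN)/NE]; rewrite eE.
  have cE : #|E| = (#|E'| + f)%N.
    rewrite /f -(cardsID [set e : {set V} | v \in e] E) addnC; congr (_ + _)%N.
      by apply: eq_card => e; rewrite !inE andbC.
    by apply: eq_card => e; rewrite !inE.
  have Um : (#|E' :|: F| <= 'C(t, 3) + 'C(t.-1, 2))%N.
    by apply: leq_trans Em; rewrite cE (leq_trans (leq_card_setU _ _)) // leq_add2l.
  have Uc : E' :|: F \subset complete_edges V.
    rewrite subUset (subset_trans FN) // andbT (subset_trans _ Ec) //.
    by apply/subsetP => e; rewrite inE => /andP[].
  have := xmax _ y Uc Um ym; rewrite wpolyU //.
  have -> : wpoly y E' = wpoly y E.
    rewrite /wpoly [RHS](bigID (fun e : {set V} => v \in e)) /= [X in _ = X + _]big1 ?add0r.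
      by apply: eq_bigl => e; rewrite inE.
    by move=> e /andP[_ ve]; rewrite (big_setD1 v) //= yv mul0r.
  rewrite (wpoly_merge (i := u)) // ?(kkt_eq _ xE xp) // sumB; lra.
pose Nv := [set n in N | v \in n]; pose Nv' := [set n in N | v \notin n].
pose A := ~: (u |: (v |: B)); pose b := #|B|; pose q := #|A|.
have vB : v \notin B by apply/negP => /neB[_]; rewrite eqxx.
have uB : u \notin v |: B.
  rewrite in_setU1 negb_or uv; apply/negP => uB.
  by have [] := neB u uB; rewrite eqxx.
have cV : #|V| = (b + q).+2.
  by rewrite -(cardsC (u |: (v |: B))) cardsU1 uB cardsU1 vB -/A -/q -/b !add1n !addSn.
have cA' : #|~: (v |: B)| = q.+1.
  have := cardsC (v |: B); rewrite cardsU1 vB cV -/b; clear; lia.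
have Nvc : Nv \subset complete_edges V by apply: subset_trans Nc; apply/subsetP => n; rewrite inE => /andP[].
(* Non-edges avoid B, so those at v have their other two vertices among the q + 1 outside v and
   B. *)
have hNv : (#|Nv| <= 'C(q.+1, 2))%N.
  rewrite -cA'; apply: (card_link_le (a := v)) => // n; first by rewrite inE => /andP[].
  rewrite inE => /andP[nN vn]; apply/subsetP => i /setD1P[iv i_n].
  rewrite in_setC in_setU1 negb_or iv; apply/negP => iB; have := BN i n iB nN.
  by rewrite i_n.
have hC : (#|C| <= 'C(q, 2))%N.
  have CN : C \subset N by apply/subsetP => n; rewrite inE => /andP[].
  apply: (card_link_le (a := u)); first exact: subset_trans CN Nc.
    by move=> n; rewrite inE => /and3P[].
  move=> n; rewrite inE => /and3P[nN un vn]; apply/subsetP => i /setD1P[iu i_n].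
  rewrite in_setC !in_setU1 !negb_or iu /=; apply/andP; split.
    by apply: contraNneq vn => <-.
  by apply/negP => iB; have := BN i n iB nN; rewrite i_n.
have cE : #|E| = (f + #|[set e in E | v \notin e]|)%N.
  rewrite -(cardsID [set e : {set V} | v \in e] E); congr (_ + _)%N.
    by apply: eq_card => e; rewrite !inE.
  by apply: eq_card => e; rewrite !inE andbC.
have cN : #|N| = (#|Nv| + #|Nv'|)%N.
  rewrite -(cardsID [set e : {set V} | v \in e] N); congr (_ + _)%N.
    by apply: eq_card => e; rewrite !inE.
  by apply: eq_card => e; rewrite !inE andbC.
have cavoid : (#|[set e in E | v \notin e]| + #|Nv'| = 'C((b + q).+1, 3))%N.
  rewrite -[(b + q).+1]/((b + q).+2.-1) -cV -(card_complete_avoid v).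
  rewrite -[RHS](cardsID E); congr (_ + _)%N; apply: eq_card => e; rewrite !inE.
    case: (boolP (e \in E)) => eE /=; last by rewrite andbF.
    by rewrite (card_triple (subsetP Ec _ eE)) eqxx andbT.
  by rewrite andbA.
have call : (#|E| + #|N| = 'C((b + q).+2, 3))%N.
  rewrite -cV -card_draws -/(complete_edges V) -(cardsID E (complete_edges V)).
  by rewrite (setIidPr Ec).
have fNv : (f + #|Nv| = 'C((b + q).+1, 2))%N.
  by move: call; rewrite cE cN binS -cavoid; clear; lia.
(* The triples avoiding v number at least 'C(t + 1, 3), hence at least |E|, because |V| >= t + 2. *)
have fNv' : (f <= #|Nv'|)%N.
  have : ('C(t.+1, 3) <= 'C((b + q).+1, 3))%N by apply: leq_bin2l; move: tV; rewrite cV; clear; lia.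
  by rewrite -cavoid binS3; move: Em; rewrite cE; clear; lia.
have b1 : (1 <= b)%N by apply/card_gt0P; exists i0.
have bin2E k : ('C(k.+1, 2) * 2 = k.+1 * k)%N.
  by rewrite mulnC -mul_bin_diag bin1.
(* The left side is twice the difference of 'C(b + q + 1, 2) and 'C(q + 1, 2). *)
have hf : (b * ((b + q) + q + 1) <= 2 * f)%N.
  have := bin2E (b + q)%N; have := bin2E q; move: hNv fNv; clear; nia.
have hC2 : (2 * #|C| <= q * q.-1)%N.
  case: (q) hC => [|q']; first by rewrite bin0n; clear; lia.
  by have := bin2E q'; clear; lia.
have q2 : (2 <= q)%N.
  have /card_gt0P[n] : (0 < #|Nv'|)%N by move: fNv' hf b1; clear; nia.
  rewrite inE => /andP[nN vn].
  rewrite -ltnS -cA' -(card_triple (subsetP Nc _ nN)); apply: subset_leq_card.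
  apply/subsetP => i i_n; rewrite in_setC in_setU1 negb_or.
  rewrite (contraNneq _ vn) => [|<-] //=; apply/negP => iB.
  by have := BN i n iB nN; rewrite i_n.
have CNv' n : n \in C -> n \in N /\ v \notin n by rewrite inE => /and3P[].
have wC F : F \subset C -> wpoly y F = (x u + x v) * \sum_(n in F) \prod_(i in n :\ u) x i.
  move=> /subsetP FC; rewrite /wpoly big_distrr; apply: eq_bigr => n /FC.
  rewrite inE => /and3P[_ un vn]; rewrite (big_setD1 u) //= yu; congr (_ * _).
  apply: eq_bigr => i /setD1P[iu i_n]; apply: yo => //.
  by apply: contraNneq vn => <-.
have mergeC F : F \subset C -> (#|F| <= f)%N ->
    (x u + x v) * \sum_(n in F) \prod_(i in n :\ u) x i <= b%:R * X * x v ^+ 2.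
  move=> FC Ff; rewrite -wC //; apply: merge => //.
    by apply: subset_trans FC _; apply/subsetP => n /CNv'[].
  by move=> n /(subsetP FC)/CNv'[].
have hs : (x u + x v) * s <= b%:R * X * x v ^+ 2 \/
    f%:R * ((x u + x v) * s) <= #|C|%:R * (b%:R * X * x v ^+ 2).
  (* All of C is swapped in if f places suffice, otherwise f of its members of at least average
     weight. *)
  case: (leqP #|C| f) => Cf; first by left; exact: mergeC.
  right; have [|F [FC Ff Fw]] := exists_heavy_subset (w := fun n => \prod_(i in n :\ u) x i) _ (ltnW Cf).
    by move=> n; exact: prodr_ge0.
  have uv0 : 0 <= x u + x v by rewrite addr_ge0.
  have := mergeC F FC; rewrite Ff => /(_ (leqnn _)) h.
  apply: le_trans (ler_wpM2l (ler0n _ #|C|) h).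
  by rewrite mulrCA [leRHS]mulrCA; apply: ler_wpM2l.
have bq4 : (4 <= b + q)%N by move: tV t4; rewrite cV; clear; lia.
have bqR : (b + q)%:R = b%:R + q%:R :> R by rewrite natrD.
have hT : (b + q)%:R * x v <= 1 - X - x u.
  have : \sum_(i : V) x v = (b + q)%:R * x v + 2 * x v.
    by rewrite sumr_const cV -[LHS]mulr_natl -addn2 natrD mulrDl.
  have [i0u _] := neB i0 i0B.
  have : 0 <= \sum_(i | (i != i0) && (i != u)) (x i - x v).
    by apply: sumr_ge0 => i _; rewrite subr_ge0.
  have : \sum_i (x i - x v) = (x i0 - x v) + ((x u - x v) + \sum_(i | (i != i0) && (i != u)) (x i - x v)).
    by rewrite (bigD1 i0) //= (bigD1 u) //= eq_sym.
  by rewrite sumrB x1 -/X => h1 h2 h3; move: h1 h2 h3; clear; lra.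
have X3 : 3 * X <= 4 * (x u + x v).
  apply: (@large_support_bound X (x u) (x v) s b%:R q%:R (b + q)%:R f%:R #|C|%:R) => //.
  - by rewrite (ler_nat _ 1).
  - by rewrite (ler_nat _ 2).
  - by rewrite (ler_nat _ 4).
  - exact: xp.
  - by rewrite -natrD -[X in _ + X]/(1%:R) -natrD -natrM -natrM ler_nat.
  - rewrite -[X in _ - X]/(1%:R) -natrB; last exact: leq_trans q2.
    by rewrite -!natrM ler_nat subn1.
(* Zero weights: any f non-edges avoiding v will do, as each weighs at least (x u)^3 under y. *)
have [|F [FN Ff _]] := exists_heavy_subset (w := fun=> 0 : R) _ fNv'; first by [].
have wF : f%:R * x u ^+ 3 <= b%:R * X * x v ^+ 2.
  have FN' n : n \in F -> n \in N /\ v \notin n by move=> /(subsetP FN); rewrite inE => /andP[].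
  apply: le_trans (merge F _ _ _); rewrite ?Ff //.
  - rewrite /wpoly -Ff mulr_natl -sumr_const; apply: ler_sum => n /FN'[nN vn].
    rewrite -(card_triple (subsetP Nc _ nN)) -prodr_const; apply: ler_prod => i i_n.
    have iv : i != v by apply: contraNneq vn => <-.
    rewrite x0 /=; case: (eqVneq i u) => [->|iu]; first by rewrite yu lerDl.
    by rewrite yo // umin.
  - by apply/subsetP => n /FN'[].
  - by move=> n /FN'[].
have hfR : b%:R * (b%:R + q%:R + q%:R + 1) <= 2 * f%:R :> R.
  by rewrite -[X in _ + X]/(1%:R) -!natrD -!natrM ler_nat.
have b1R : 1 <= b%:R :> R by rewrite (ler_nat _ 1).
have q2R : 2 <= q%:R :> R by rewrite (ler_nat _ 2).
have bq4R : 4 <= b%:R + q%:R :> R by rewrite -natrD (ler_nat _ 4).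
have xu0 := xp u; have xv0 := xp v; have xuv : x v <= x u := vmin u.
have f7 : 7 * b%:R <= 2 * f%:R :> R.
  by apply: le_trans hfR; rewrite mulrC ler_wpM2l //; move: bq4R q2R; clear; lra.
have : 7 * b%:R * x u ^+ 3 <= 2 * (b%:R * X * x u ^+ 2).
  apply: (@le_trans _ _ (2 * f%:R * x u ^+ 3)).
    by rewrite ler_wpM2r // exprn_ge0 // ltW.
  rewrite -mulrA ler_wpM2l //; apply: le_trans wF _.
  by rewrite ler_wpM2l ?mulr_ge0 ?x0 // ler_sqr ?nnegrE.
have bu0 : 0 < b%:R * x u ^+ 2 by rewrite mulr_gt0 ?exprn_gt0 // (lt_le_trans _ b1R).
have -> : 7 * b%:R * x u ^+ 3 = b%:R * x u ^+ 2 * (7 * x u) by ring.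
have -> : 2 * (b%:R * X * x u ^+ 2) = b%:R * x u ^+ 2 * (2 * X) by ring.
(* Now 7 x u <= 2 X, whereas [X3] and x v <= x u give 3 X <= 8 x u. *)
rewrite ler_pM2l //; move: X3 xuv xu0; clear; lra.
Qed.

End LargeSupport.

(** * Restriction to the support by relabelling *)

Section Relabelling.
Variables (R : realType) (V W : finType) (phi : W -> V).
Hypothesis phi_inj : injective phi.
Implicit Types (E : {set {set V}}) (F : {set {set W}}).

Definition pull_edges E : {set {set W}} := [set e : {set W} | phi @: e \in E].
Definition push_edges F : {set {set V}} := [set phi @: e | e : {set W} in F].
(** For injective [phi] the sum has at most one term; it extends y by 0 without choosing an
    inverse. *)
Definition push_weight (y : W -> R) : V -> R := fun v => \sum_(w | phi w == v) y w.

Lemma push_weightE y w : push_weight y (phi w) = y w.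
Proof. by rewrite /push_weight (big_pred1 w) // => i; rewrite /= inj_eq. Qed.

Lemma push_pull (x : V -> R) v : (forall v, x v != 0 -> exists w, phi w = v) ->
  push_weight (x \o phi) v = x v.
Proof.
move=> xphi; case: (eqVneq (x v) 0) => [xv|/xphi[w <-]]; last by rewrite push_weightE.
by rewrite /push_weight big1 // => w /eqP /= ->.
Qed.

Lemma push_weight_simplex y : @simplex R W y -> @simplex R V (push_weight y).
Proof.
move=> [y0 y1]; split=> [v|]; first exact: sumr_ge0.
by rewrite -y1 [RHS](partition_big phi predT).
Qed.

Lemma wpoly_push y F : wpoly (push_weight y) (push_edges F) = wpoly y F.
Proof.
rewrite /wpoly big_imset /=; last by move=> e f _ _; exact: imset_inj.
apply: eq_bigr => e _; rewrite big_imset /=; last by move=> i j _ _; exact: phi_inj.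
by apply: eq_bigr => i _; rewrite push_weightE.
Qed.

Lemma push_edges_complete F :
  F \subset complete_edges W -> push_edges F \subset complete_edges V.
Proof.
move=> /subsetP Fc; apply/subsetP => _ /imsetP[e eF ->].
by rewrite inE card_imset // (card_triple (Fc _ eF)).
Qed.

(** An edge not contained in the image of [phi] has a vertex of weight 0 and contributes nothing. *)
Lemma wpoly_pull (x : V -> R) E : (forall v, x v != 0 -> exists w, phi w = v) ->
  wpoly x E = wpoly (x \o phi) (pull_edges E).
Proof.
move=> xphi; have -> : wpoly (x \o phi) (pull_edges E) = wpoly x (push_edges (pull_edges E)).
  rewrite /wpoly [RHS]big_imset /=; last by move=> e f _ _; exact: imset_inj.
  apply: eq_bigr => e _; rewrite [RHS]big_imset //=.
  by move=> i j _ _; exact: phi_inj.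
rewrite /wpoly (bigID (mem (push_edges (pull_edges E)))) /= addrC big1 ?add0r.
  apply: eq_bigl => e; apply/andP/idP => [[]//|eF]; split=> //.
  by case/imsetP: eF => f; rewrite inE => fE ->.
move=> e /andP[eE]; case: (pickP [pred i | (i \in e) && (x i == 0)]) => /=.
  by move=> i /andP[ie /eqP xi] _; rewrite (big_setD1 i) //= xi mul0r.
move=> xe; suff -> : e \in push_edges (pull_edges E) by [].
have eE' : e = phi @: (phi @^-1: e).
  apply/setP => v; apply/idP/imsetP => [ve|[w + ->]]; last by rewrite inE.
  have [|w wv] := xphi v; first by have := xe v; rewrite /= ve /= => ->.
  by exists w; rewrite ?inE wv.
by rewrite eE' imset_f // inE -eE'.
Qed.

(** Competitors on W push forward to competitors on V of the same value. This makes all weights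
    positive, as the first order conditions require. *)
Lemma extremal_pull m E (x : V -> R) : (forall v, x v != 0 -> exists w, phi w = v) ->
  extremal m E x -> extremal m (pull_edges E) (x \o phi).
Proof.
move=> xphi xE; have [/subsetP Ec Em [x0 x1] xmax] := xE; split.
- apply/subsetP => e; rewrite !inE => /Ec/card_triple.
  by rewrite card_imset // => ->.
- apply: leq_trans Em; rewrite -(card_imset _ (imset_inj phi_inj)).
  by apply: subset_leq_card; apply/subsetP => _ /imsetP[e + ->]; rewrite inE.
- split=> [w|]; first exact: x0.
  rewrite -x1 [LHS](partition_big phi predT) //=; apply: eq_bigr => v _.
  exact: push_pull.
- move=> F y Fc Fm yS; rewrite -wpoly_pull // -wpoly_push; apply: xmax.
  + exact: push_edges_complete.
  + by rewrite (leq_trans (leq_imset_card _ _)).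
  + exact: push_weight_simplex.
Qed.

End Relabelling.

(** Numbering by decreasing weight lets [threshold] yield left-compression. *)
Lemma sorted_enum (R : realType) (V : finType) (x : V -> R) (S : {set V}) :
  exists phi : 'I_#|S| -> V, [/\ injective phi,
    forall v, (v \in S) = [exists i, phi i == v] &
    forall i j : 'I_#|S|, (i <= j)%N -> x (phi j) <= x (phi i)].
Proof.
pose s := sort (fun a b => x b <= x a) (enum S).
have ss : size s = #|S| by rewrite size_sort cardE.
have ms v : (v \in s) = (v \in S) by rewrite mem_sort mem_enum.
have su : uniq s by rewrite sort_uniq enum_uniq.
have st : sorted (fun a b => x b <= x a) s.
  by apply: sort_sorted => a b; exact: le_total.
pose phi (i : 'I_#|S|) := tnth (Tuple (introT eqP ss)) i.
have phiE v0 i : phi i = nth v0 s i by rewrite /phi (tnth_nth v0).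
exists phi; split.
- move=> i j; have v0 : V := phi i; rewrite !(phiE v0) => /eqP.
  by rewrite nth_uniq ?ss // => /eqP/val_inj.
- move=> v; rewrite -ms; apply/idP/existsP => [vs|[i /eqP <-]]; last first.
    by have v0 : V := phi i; rewrite (phiE v0) mem_nth ?ss.
  have vi : (index v s < #|S|)%N by rewrite -ss index_mem.
  by exists (Ordinal vi); rewrite (phiE v) nth_index.
- move=> i j ij; have v0 : V := phi i; rewrite !(phiE v0).
  apply: (@sorted_leq_nth _ (fun a b => x b <= x a)) => //; rewrite ?inE ?ss //.
  by move=> a b c ba ca; exact: le_trans ca ba.
Qed.

(** * Existence of optimal pairs and of minimal supports *)

Section Existence.
Variables (R : realType) (V : finType) (m : nat).
Implicit Types (x y : V -> R) (E F : {set {set V}}).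

Definition support x : {set V} := [set i | x i != 0].

Lemma exists_extremal : (0 < #|V|)%N -> exists E x, @extremal R V m E x.
Proof.
move=> V0.
pose P E := (E \subset complete_edges V) && (#|E| <= m)%N.
have maxE E : P E -> exists2 x, @simplex R V x &
    forall y, @simplex R V y -> wpoly y E <= wpoly x E.
  case/andP => /subsetP Ec _.
  pose G := ThreeGraph (fun e (eE : e \in E) => card_triple (Ec e eE)).
  by have [x xS [_ xmax]] := lagrangian_max R G V0; exists x.
pose val E := sup [set wpoly y E | y in @simplex R V]%classic.
have valE E x : @simplex R V x -> (forall y, @simplex R V y -> wpoly y E <= wpoly x E) ->
    val E = wpoly x E.
  move=> xS xmax; apply/eqP; rewrite eq_le; apply/andP; split.
    by apply: ge_sup => [|_ [y yS <-]]; [exists (wpoly x E), x | exact: xmax].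
  by apply: ub_le_sup; [exists (wpoly x E) => _ [y yS <-]; exact: xmax | exists x].
have P0 : P set0 by rewrite /P sub0set cards0.
case: (@arg_maxP _ _ _ set0 P val P0) => E PE Emax.
have [x xS xmax] := maxE E PE; exists E, x; have /andP[Ec Em] := PE; split=> //.
move=> F y Fc Fm yS; have PF : P F by rewrite /P Fc.
have [z zS zmax] := maxE F PF.
by apply: le_trans (zmax y yS) _; rewrite -(valE _ _ zS zmax) -(valE _ _ xS xmax); exact: Emax.
Qed.

(** Only the weighting changes, so a clique found with x' is a clique of the original E. *)
Lemma exists_min_support E x : extremal m E x -> exists x', [/\ extremal m E x',
  wpoly x' E = wpoly x E &
  forall y, @simplex R V y -> wpoly y E = wpoly x E -> (#|support x'| <= #|support y|)%N].
Proof.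
move=> xE; have [Ec Em xS xmax] := xE.
pose P n := `[< exists y, [/\ @simplex R V y, wpoly y E = wpoly x E & #|support y| = n] >].
have : exists n, P n by exists #|support x|; apply/asboolP; exists x.
case/ex_minnP => n /asboolP[x' [x'S x'E nE]] nmin.
exists x'; split=> //; first by split=> // F y Fc Fm yS; rewrite x'E; exact: xmax.
by move=> y yS yE; rewrite nE; apply: nmin; apply/asboolP; exists y.
Qed.

End Existence.

(** * Optimal pairs of value at least [lam] have a t-clique *)

Section Main.
Variables (R : realType) (t : nat) (lam : R).
Hypothesis t_ge4 : (4 <= t)%N.
Hypothesis lam_ge : clique_value R t <= lam.
Let m := ('C(t, 3) + 'C(t.-1, 2))%N.
Hypothesis compressed_lt : forall G : three_graph 'I_t.+1,
  left_compressed G -> #|edges G| = m ->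
  ~ is_clique G [set i : 'I_t.+1 | (i < t)%N] -> lagrangian R G < lam.

Lemma ordinal_set3 k (i j l : 'I_k) : (i < j)%N -> (j < l)%N ->
  i != j /\ (j != l /\ i \notin [set j; l]).
Proof.
move=> ij jl; rewrite !inE negb_or -!val_eqE /= ltn_eqF // (ltn_eqF jl).
by rewrite ltn_eqF // (ltn_trans ij).
Qed.

(** Case distinction on k against t and t + 1; [lam] stands for the Lagrangian of the t-clique. For
    k = t + 1 without a t-clique, E is left-compressed with m edges and [compressed_lt] contradicts
    the value. *)
Lemma extremal_clique_ord k (E : {set {set 'I_k}}) (x : 'I_k -> R) :
  extremal m E x -> (forall i, 0 < x i) ->
  (forall i j : 'I_k, (i <= j)%N -> x j <= x i) ->
  (forall i j, i != j -> 0 < pderiv x E [set i; j]) -> lam <= wpoly x E ->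
  wpoly x E <= clique_value R t /\ exists2 K : {set 'I_k}, #|K| = t &
    forall e : {set 'I_k}, e \subset K -> #|e| = 3%N -> e \in E.
Proof.
move=> xE xp xanti cover lamE; have [Ec Em xS xmax] := xE.
have t3 : (3 <= t)%N by apply: leq_trans t_ge4.
case: (leqP k t) => kt.
  have [||xt kt' cE] := extremal_small (t := t) t3 _ xE xp; first by rewrite card_ord.
    exact: le_trans lamE.
  split=> //; exists setT; first by rewrite cardsT.
  by move=> e _ e3; apply: (subsetP cE); rewrite inE e3.
case: (ltnP t.+1 k) => kt'; first by case: (extremal_large (t := t) t_ge4 _ xE xp cover); rewrite card_ord.
have {kt kt'} ek : k = t.+1 by apply/eqP; rewrite eqn_leq kt' kt.
subst k.
case: (pselect (exists2 K : {set 'I_t.+1}, #|K| = t &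
    forall e : {set 'I_t.+1}, e \subset K -> #|e| = 3%N -> e \in E)) => [[K Kt KE]|noK].
  by split; [apply: (extremal_clique_succ t3 _ xE xp Kt KE); rewrite card_ord | exists K].
pose G := ThreeGraph (fun e (eE : e \in E) => card_triple (subsetP Ec e eE)).
have mle : (m < #|complete_edges 'I_t.+1|)%N.
  by rewrite card_draws card_ord binS3 -addn1 leq_add2l -ltnS prednK; apply: leq_trans t3.
have [f fc fE] : exists2 f, f \in complete_edges 'I_t.+1 & f \notin E.
  apply/subsetPn; apply/negP => /subset_leq_card cE.
  by have := leq_trans mle (leq_trans cE Em); rewrite ltnn.
have cm : #|edges G| = m := nonedge_card xE xp fE (card_triple fc).
have ncl : ~ is_clique G [set i : 'I_t.+1 | (i < t)%N].
  move=> cl; apply: noK; exists [set i : 'I_t.+1 | (i < t)%N]; last exact: cl.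
  have -> : [set i : 'I_t.+1 | (i < t)%N] = [set~ ord_max].
    by apply/setP => i; rewrite !inE -val_eqE /= ltn_neqAle -ltnS ltn_ord andbT.
  by rewrite cardsC1 card_ord.
(* Smaller indices carry larger weights, so a violation would be a non-edge at least as heavy as an
   edge. *)
have lc : left_compressed G.
  move=> i1 i2 i3 j1 j2 j3 j12 j23 jE i12 i23 ij1 ij2 ij3.
  have [i12' [i23' ni]] := ordinal_set3 i12 i23.
  have [j12' [j23' nj]] := ordinal_set3 j12 j23.
  apply/negPn/negP => iE.
  have i3c : #|[set i1; i2; i3]| = 3%N by rewrite -setUA cardsU1 ni cards2 i23'.
  have := threshold xE xp jE iE i3c; rewrite -!setUA !prod_triple // ltNge.
  by move/negP; apply; rewrite !ler_pM ?mulr_ge0 ?xanti // ltW.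
have := compressed_lt lc cm ncl; rewrite ltNge => /negP[].
apply: (le_trans lamE); have [y yS [-> ymax]] := lagrangian_max R G (ltac:(by rewrite card_ord)).
exact: ymax.
Qed.

Lemma extremal_clique (V : finType) (E : {set {set V}}) (x : V -> R) :
  extremal m E x -> lam <= wpoly x E ->
  wpoly x E <= clique_value R t /\ exists2 K : {set V}, #|K| = t &
    forall e : {set V}, e \subset K -> #|e| = 3%N -> e \in E.
Proof.
move=> /exists_min_support[x' [xE <- supp_min]] lamE.
have [Ec Em [x0 x1] xmax] := xE.
have [phi [phi_inj phiS phi_anti]] := sorted_enum x' (support x').
have xphi v : x' v != 0 -> exists w, phi w = v.
  move=> xv; have : v \in support x' by rewrite inE.
  by rewrite phiS => /existsP[w /eqP <-]; exists w.
have phi0 i : 0 < x' (phi i).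
  rewrite lt_def x0 andbT; suff : phi i \in support x' by rewrite inE.
  by rewrite phiS; apply/existsP; exists i.
have wE := wpoly_pull phi_inj E xphi.
(* If the mixed derivative vanished, merging j into i would be free and would shrink the support. *)
have cover i j : i != j -> 0 < pderiv (x' \o phi) (pull_edges phi E) [set i; j].
  move=> ij; have pE := extremal_pull phi_inj xphi xE.
  rewrite lt_def pderiv_ge0 ?andbT; last by move=> k; exact: x0.
  apply/eqP => p0.
  have [_ _ yS _] := pE; set y := x' \o phi in pE p0 yS wE.
  have zS : @simplex R _ (transfer y i j (y j)).
    by apply: simplex_transfer => //; rewrite lexx x0.
  set z := transfer y i j (y j) in zS *.
  have zphi v : push_weight phi z v != 0 -> exists w, phi w = v.
    case: (pickP (fun w => phi w == v)) => [w /eqP <-|h]; first by exists w.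
    by rewrite /push_weight big_pred0 // eqxx.
  have zE : wpoly (push_weight phi z) E = wpoly x' E.
    rewrite (wpoly_pull phi_inj E zphi) wE -[RHS]subr0 -(mulr0 (y j ^+ 2)) -p0.
    rewrite -wpoly_merge // ?(kkt_eq _ pE phi0) //.
    by apply: eq_bigr => e _; apply: eq_bigr => k _; exact: push_weightE.
  have := supp_min _ (push_weight_simplex phi zS) zE.
  apply/negP; rewrite -ltnNge.
  have jS : (0 < #|support x'|)%N by apply: leq_ltn_trans (ltn_ord j).
  apply: (@leq_ltn_trans #|phi @: [set~ j]|); last first.
    by rewrite card_imset // cardsC1 card_ord ltn_predL.
  apply: subset_leq_card; apply/subsetP => v; rewrite inE => zv.
  have [w wv] := zphi v zv; rewrite -wv imset_f // !inE.
  apply: contraNneq zv => wj; rewrite -wv push_weightE // wj /z /transfer.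
  by rewrite eqxx (eq_sym j) (negPf ij) sub0r mulrN1 subrr.
have [] := extremal_clique_ord (extremal_pull phi_inj xphi xE) phi0 phi_anti cover.
  by rewrite -wE.
rewrite -wE => le [K Kt KE]; split=> //; exists (phi @: K).
  by rewrite card_imset.
move=> e eK e3.
have eE : e = phi @: (phi @^-1: e).
  apply/setP => v; apply/idP/imsetP => [ve|[w + ->]]; last by rewrite inE.
  by have /imsetP[w wK vw] := subsetP eK v ve; exists w; rewrite // inE -vw.
have : phi @^-1: e \in pull_edges phi E.
  apply: KE; last by rewrite -e3 {2}eE card_imset.
  apply/subsetP => w; rewrite inE => /(subsetP eK)/imsetP[w' w'K].
  by move/phi_inj => ->.
by rewrite inE -eE.
Qed.

End Main.

(** * The value of the t-clique and the final deduction *)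

Lemma clique_value_le_lagrangian (R : realType) t : (0 < t)%N ->
  clique_value R t <= lagrangian R (complete_three_graph t).
Proof.
move=> t0; have t0R : t%:R != 0 :> R by rewrite pnatr_eq0 -lt0n.
have [|x xS [-> xmax]] := lagrangian_max R (complete_three_graph t); first by rewrite card_ord.
pose u : 'I_t -> R := fun=> t%:R^-1.
have uS : @simplex R _ u.
  split=> [i|]; first by rewrite invr_ge0.
  by rewrite sumr_const card_ord -[LHS]mulr_natl divff.
apply: le_trans (xmax u uS); rewrite clique_value_le //.
have -> : lagrangian_poly (complete_three_graph t) u = 'C(t, 3)%:R * t%:R^-1 ^+ 3.
  rewrite /lagrangian_poly (eq_bigr (fun=> t%:R^-1 ^+ 3)).
    by rewrite sumr_const card_draws card_ord mulr_natl.
  by move=> e /card_triple e3; rewrite prodr_const e3.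
have := congr1 (fun n => n%:R : R) (bin_ffact t 3).
have -> : (t ^_ 3 = t * (t.-1 * t.-2))%N by rewrite !ffactnS ffactn0 muln1.
rewrite -[3`!]/6%N natrM => h.
have -> : 6 * t%:R ^+ 2 * ('C(t, 3)%:R * t%:R^-1 ^+ 3) = 'C(t, 3)%:R * 6 / t%:R :> R by field.
rewrite h natrM [leRHS]mulrC mulKf // natrM.
case: t t0 {t0R x xS xmax u uS h} => [|[|t]] // _; first by rewrite subrr !mul0r.
by rewrite le_eqVlt; apply/orP; left; apply/eqP; rewrite /= -!natr1; ring.
Qed.

Theorem theorem1p9 (R : realType) (l : nat) (l_gt0 : (0 < l)%N)
  (Hcompressed : forall G : three_graph 'I_l,
     left_compressed G ->
     #|edges G| = ('C(l - 1, 3) + 'C(l - 2, 2))%N ->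
     ~ is_clique G [set i : 'I_l | (i < l - 1)%N]%SET ->
     lagrangian R G < lagrangian R (complete_three_graph (l - 1))) :
  forall (m : nat) (V : finType) (G : three_graph V),
    (1 < #|V|)%N ->
    ('C(l - 1, 3) <= m <= 'C(l - 1, 3) + 'C(l - 2, 2))%N ->
    #|edges G| = m ->
    ~ has_clique G (l - 1) ->
    lagrangian R G < lagrangian R (complete_three_graph (l - 1)).
Proof.
move=> m V G V1 /andP[m_ge m_le] cG noK.
have [t lt] : exists t, l = t.+1 by exists l.-1; rewrite prednK.
subst l; move: Hcompressed m_ge m_le noK.
rewrite subSS subn0 subSS subn1 => Hcompressed m_ge m_le noK.
(* For t < 3 any t vertices form a clique vacuously; for t = 3 there is at least one edge, which is
   a clique. *)
have t4 : (4 <= t)%N.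
  rewrite ltnNge; apply/negP => t3; apply: noK.
  case: (ltnP t 3) => t2.
    have [|K [_ Kt _]] := @exists_heavy_subset R V (fun=> 0) setT t (fun=> lexx _).
      by rewrite cardsT (leq_trans _ V1).
    exists K => // e /subset_leq_card eK e3; move: eK; rewrite Kt.
    by rewrite (_ : #|e| = 3%N) // leqNgt t2.
  have {t2 t3} t3 : t = 3%N by apply/eqP; rewrite eqn_leq t3 t2.
  have /card_gt0P[e eG] : (0 < #|edges G|)%N by rewrite cG (leq_trans _ m_ge) // t3.
  have e3 : #|e| = 3%N := edges_card3 eG.
  exists e; first by rewrite e3.
  move=> f fe f3; rewrite (_ : f = e) //; apply/eqP.
  by rewrite eqEcard fe e3 (_ : #|f| = 3%N).
rewrite ltNge; apply/negP => lamG.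
have V0 : (0 < #|V|)%N := ltnW V1.
have t0 : (0 < t)%N by apply: leq_trans t4.
have lam_ge := clique_value_le_lagrangian R t0.
have [E [x xE]] := exists_extremal R ('C(t, 3) + 'C(t.-1, 2)) V0.
have [_ _ _ xmax] := xE.
have Gc : edges G \subset complete_edges V.
  by apply/subsetP => e eG; rewrite inE; apply/eqP; exact: (edges_card3 eG).
have Gm : (#|edges G| <= 'C(t, 3) + 'C(t.-1, 2))%N by rewrite cG.
have [z zS [zE _]] := lagrangian_max R G V0; rewrite zE in lamG.
have lamE := le_trans lamG (xmax _ z Gc Gm zS).
have [wE _] := extremal_clique t4 lam_ge Hcompressed xE lamE.
(* The maximum is at most [clique_value], hence at most the value of G at z, so G with z is itself
   optimal. *)
have zG : extremal ('C(t, 3) + 'C(t.-1, 2)) (edges G) z.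
  split=> // F y Fc Fm yS; apply: le_trans (xmax F y Fc Fm yS) _.
  exact: le_trans wE (le_trans lam_ge lamG).
have [_ [K Kt KG]] := extremal_clique t4 lam_ge Hcompressed zG lamG.
by apply: noK; exists K.
Qed.
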